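(* Let $\alpha>0$ with $\alpha\notin\{1,2,3,\dots\}$, let $n=[\alpha]+1$, and let $m\in(0,1]$. Let $I\subset[0,\infty)$ be an interval, let $a,b\in I$ with $a<b$, and assume $y/m\in I$ for every $y\in[a,b]$. Let $f:I\to\mathbb{R}$ be $(n+1)$ times differentiable on $I$, with $f\in AC^{n}[a,b]$ and $f^{(n+1)}\in L[a,b]$. If $|f^{(n+1)}|$ is $m$-convex on $[a,b]$, then $$\left|\frac{f^{(n)}(a)+f^{(n)}(b)}{2}-\frac{\Gamma(n-\alpha+1)}{2(b-a)^{n-\alpha}}\left[({}^{C}D_{a^{+}}^{\alpha}f)(b)+(-1)^{n}({}^{C}D_{b^{-}}^{\alpha}f)(a)\right]\right|$$ $$\le \frac{b-a}{2}\left(\frac{1}{2(n-\alpha+1)}+\frac{1}{2(n-\alpha+2)}\right)\left(\left|f^{(n+1)}(a)\right|+m\left|f^{(n+1)}\left(\tfrac{b}{m}\right)\right|\right).$$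
   Context: $[\alpha]$ is the integer part of $\alpha$, $\Gamma$ is the Gamma function, $L[a,b]$ is the space of Lebesgue integrable functions on $[a,b]$, and $AC^{n}[a,b]$ is the space of functions whose $n$-th derivative is absolutely continuous on $[a,b]$. At endpoints of $I$ belonging to $I$, derivatives are one-sided. Caputo fractional derivatives of order $\alpha$ (with $n=[\alpha]+1$): $$({}^{C}D_{a^{+}}^{\alpha}f)(x)=\frac{1}{\Gamma(n-\alpha)}\int_a^x\frac{f^{(n)}(t)}{(x-t)^{\alpha-n+1}}\,dt\quad(x>a),$$ $$({}^{C}D_{b^{-}}^{\alpha}f)(x)=\frac{(-1)^n}{\Gamma(n-\alpha)}\int_x^b\frac{f^{(n)}(t)}{(t-x)^{\alpha-n+1}}\,dt\quad(x<b).$$ $m$-convexity: for $m\in(0,1]$, a function $g:I\to\mathbb{R}$ is called $m$-convex on $[c,d]\subset I$ (where $y/m\in I$ for all $y\in[c,d]$) if for all $x,y\in[c,d]$ and $t\in[0,1]$, $$g(tx+(1-t)y)=g\left(tx+m(1-t)\tfrac{y}{m}\right)\le t\,g(x)+m(1-t)\,g\left(\tfrac{y}{m}\right).$$ *)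

(* Defs.v *)
(* A function on an interval I is represented by a total
   function R -> R, of which only the values on I are ever used. *)
From HB Require Import structures.
From mathcomp Require Import all_boot all_order all_algebra.
From mathcomp Require Import all_classical all_reals all_analysis.
Set Implicit Arguments.
Unset Strict Implicit.
Unset Printing Implicit Defensive.
Import Order.TTheory GRing.Theory Num.Theory.
Import numFieldNormedType.Exports.
Local Open Scope classical_set_scope.
Local Open Scope ring_scope.

Section Derivatives.
Context {R : realType}.
Implicit Types (I : set R) (f : R -> R).

(* The variable y ranges over I minus x, so at an endpoint of I belonging to I
   these are the one-sided notions. *)
Definition diff_quot_on I f (x : R) : set_system R :=
  (f y - f x) / (y - x) @[y --> within I x^'].

Definition derivable_on I f (x : R) : Prop := cvg (diff_quot_on I f x).

Definition derive_on I f (x : R) : R := lim (diff_quot_on I f x).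

Definition deriven_on I (k : nat) f : R -> R := iter k (derive_on I) f.

Definition n_derivable_on I (k : nat) f : Prop :=
  forall j : nat, (j < k)%N ->
  forall x : R, I x -> derivable_on I (deriven_on I j f) x.

End Derivatives.

Section FunctionSpaces.
Context {R : realType}.

Definition abs_continuous (a b : R) (F : R -> R) : Prop :=
  forall e : R, 0 < e -> exists2 d : R, 0 < d &
  forall (N : nat) (u v : 'I_N -> R),
    (forall i, [/\ a <= u i, u i < v i & v i <= b]) ->
    trivIset setT (fun i => `]u i, v i[%classic) ->
    \sum_(i < N) (v i - u i) < d ->
    \sum_(i < N) `|F (v i) - F (u i)| < e.

(* The derivatives are those of f on the interval I, which contains [a, b]. *)
Definition AC_space (I : set R) (n : nat) (a b : R) (f : R -> R) : Prop :=
  n_derivable_on I n f /\ abs_continuous a b (deriven_on I n f).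

Definition Lebesgue_integrable (a b : R) (g : R -> R) : Prop :=
  (@lebesgue_measure R).-integrable `[a, b] (EFin \o g).

End FunctionSpaces.

Section Caputo.
Context {R : realType}.

(* Euler's integral; meaningful for z > 0. *)
Definition Gamma (z : R) : R :=
  \int[@lebesgue_measure R]_(t in `]0, +oo[) (t `^ (z - 1) * expR (- t)).

(* truncn is the integer part of a nonnegative real. *)
Definition caputo_left (I : set R) (alpha a : R) (f : R -> R) (x : R) : R :=
  let n := (Num.truncn alpha).+1 in
  (Gamma (n%:R - alpha))^-1 *
  \int[@lebesgue_measure R]_(t in `[a, x])
    (deriven_on I n f t / (x - t) `^ (alpha - n%:R + 1)).

Definition caputo_right (I : set R) (alpha b : R) (f : R -> R) (x : R) : R :=
  let n := (Num.truncn alpha).+1 in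
  (-1) ^+ n / Gamma (n%:R - alpha) *
  \int[@lebesgue_measure R]_(t in `[x, b])
    (deriven_on I n f t / (t - x) `^ (alpha - n%:R + 1)).

End Caputo.

Definition m_convex (R : realType) (m c d : R) (g : R -> R) : Prop :=
  forall x y t : R, c <= x <= d -> c <= y <= d -> 0 <= t <= 1 ->
    g (t * x + (1 - t) * y) <= t * g x + m * (1 - t) * g (y / m).

(* Main.v *)
(* Put F = f^(n), G = f^(n+1), beta = n - alpha, h = b - a.  Since G may fail to be
   continuous, no integration by parts is used.  The m-convexity of |G|, applied at x
   and at a + b - x, gives |G x| + |G (a + b - x)| <= C with
   C = |G a| + m |G (b / m)|, so by the mean value theorem
   P t = F a + F b - F t - F (a + b - t) satisfies
   |P t| <= C min(t - a, b - t) <= 2 C (t - a) (b - t) / h.  Reflecting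
   t -> a + b - t in the left Caputo integral turns the quantity to be estimated into
   beta / (2 h^beta) times the integral of P t (t - a)^(beta - 1); the bound on P makes
   it at most C h beta / ((beta + 1) (beta + 2)), and 4 beta <= 2 beta + 3. *)
Require Import Defs.
From HB Require Import structures.
From mathcomp Require Import all_boot all_order all_algebra.
From mathcomp Require Import all_classical all_reals all_analysis.
From mathcomp Require Import measurable_realfun ring lra.
Import Order.TTheory GRing.Theory Num.Theory.
Import numFieldNormedType.Exports.
Local Open Scope classical_set_scope.
Local Open Scope ring_scope.

(** * Integration of powers singular at the left endpoint *)

Lemma ge0_FTC2_oc (R : realType) (f F : R -> R) (a b : R) : a < b ->
  (forall x, a < x <= b -> 0 <= f x) ->
  (forall x, a < x <= b -> {for x, continuous f}) ->
  (forall x, a < x <= b -> is_derive x 1 F (f x)) ->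
  F x @[x --> a^'+] --> F a ->
  (\int[@lebesgue_measure R]_(x in `[a, b]) (f x)%:E = (F b - F a)%:E)%E.
Proof.
move=> ab f0 cf dF Fa.
(* The shift [k.+2] keeps [u k < b] already at [k = 0], so that every interval [[u k, b]] is
   nondegenerate. *)
pose u k : R := a + (b - a) / k.+2%:R.
have h0 : 0 < b - a by rewrite subr_gt0.
have au k : a < u k by rewrite ltrDl divr_gt0.
have ub k : u k < b.
  by rewrite -ltrBrDl ltr_pdivrMr ?ltr0n// ltr_pMr// ltr1n.
have uV k x : u k <= x <= b -> a < x <= b.
  by move=> /andP[ux ->]; rewrite (lt_le_trans (au k) ux).
have cvgu : u k @[k --> \oo] --> a^'+.
  have : u k @[k --> \oo] --> a.
    rewrite -[X in _ --> X]addr0 -[X in _ + X](mulr0 (b - a)).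
    apply: cvgD; first exact: cvg_cst.
    apply: cvgM; first exact: cvg_cst.
    have := @cvg_harmonic R; rewrite -(cvg_shiftn 1)/=.
    by under eq_fun do rewrite addn1.
  move=> ua P /= [e e0 aeP].
  have uae : \forall k \near \oo, `|a - u k| < e by exact: cvgr_dist_lt ua _ e0.
  change (\forall k \near \oo, P (u k)).
  by apply: filterS uae => k ke; apply: aeP; [exact: ke|exact: au].
have bigU : \bigcup_k `[u k, b]%classic = `]a, b]%classic.
  apply/seteqP; split => x /=.
    by move=> [k _] /=; rewrite !in_itv/= => /uV.
  rewrite in_itv/= => /andP[ax xb].
  have : \forall k \near \oo, u k < x.
    have /cvgr_lt : u k @[k --> \oo] --> a.
      by apply: cvg_trans cvgu _; exact: cvg_within.
    exact.
  by move=> [k _ /(_ k (leqnn k)) /= /ltW ukx]; exists k => //=; rewrite in_itv/= ukx.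
have mf : measurable_fun (`]a, b] : set R) f.
  rewrite -bigU; apply/measurable_fun_bigcup => // k.
  apply: subspace_continuous_measurable_fun => //.
  apply: continuous_in_subspaceT => x; rewrite inE/= in_itv/= => /uV; exact: cf.
(* The point [a], where nothing is assumed of [f], has measure zero and is dropped from the
   domain. *)
rewrite -integral_itv_obnd_cbnd//; last exact/measurable_EFinP.
rewrite -bigU.
have intk k : (\int[@lebesgue_measure R]_(x in `[u k, b]) (f x)%:E
    = (F b - F (u k))%:E)%E.
  rewrite EFinB; apply: continuous_FTC2 => //.
  - apply: continuous_in_subspaceT => x; rewrite inE/= in_itv/= => /uV; exact: cf.
  - have cF x : a < x <= b -> {for x, continuous F}.
      by move=> /dF[dFx _]; apply/differentiable_continuous/derivable1_diffP.
    split.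
    + move=> x; rewrite in_itv/= => /andP[/ltW ux /ltW xb].
      by have [] := dF x (uV k x _); rewrite ?ux.
    + by apply: cvg_at_right_filter; apply: cF; rewrite au ltW.
    + by apply: cvg_at_left_filter; apply: cF; rewrite ab lexx.
  - move=> x; rewrite in_itv/= => /andP[/ltW ux /ltW xb].
    have /dF dFx : a < x <= b by apply: (uV k); rewrite ux.
    by rewrite derive1E derive_val.
have ndF : nondecreasing_seq (fun k => `[u k, b]%classic : set R).
  apply/nondecreasing_seqP => k; apply/subsetPset => x/=.
  rewrite !in_itv/= => /andP[ukx ->]; rewrite andbT (le_trans _ ukx)//.
  by rewrite lerD2l ler_pM2l// lef_pV2 ?posrE ?ltr0n// ler_nat.
have intU : (\int[@lebesgue_measure R]_(x in `[u k, b]) (f x)%:E @[k --> \oo] -->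
    \int[@lebesgue_measure R]_(x in \bigcup_k `[u k, b]%classic) (f x)%:E)%E.
  apply: ge0_nondecreasing_set_cvg_integral => //.
  - move=> k; apply/measurable_EFinP; apply: measurable_funS mf => //.
    by move=> x /=; rewrite !in_itv/= => /uV.
  - by move=> k x /=; rewrite in_itv/= lee_fin => /uV; exact: f0.
rewrite -(cvg_lim _ intU)//.
apply/cvg_lim => //; rewrite (eq_cvg _ _ intk).
apply: cvg_EFin; first exact: nearW.
have cFu : F (u k) @[k --> \oo] --> F a by exact: cvg_comp cvgu Fa.
by apply: cvg_trans (cvgB (cvg_cst (F b)) cFu).
Qed.

Lemma integral_powR_shift (R : realType) (a b c : R) : a < b -> 0 < c ->
  (\int[@lebesgue_measure R]_(x in `[a, b]) ((x - a) `^ (c - 1))%:E =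
   ((b - a) `^ c / c)%:E)%E.
Proof.
move=> ab c0.
have cN0 : c != 0 by rewrite gt_eqF.
have isd (r x : R) : a < x ->
    is_derive x 1 (fun x => (x - a) `^ r) (r * (x - a) `^ (r - 1)).
  move=> ax; have xa0 : 0 < x - a by rewrite subr_gt0.
  have := @is_derive1_comp _ (fun x : R => x `^ r) (fun x => x - a) x _ _
    (is_derive1_powR r xa0) (is_deriveB (is_derive_id x 1) (is_derive_cst a x 1)).
  by rewrite subr0 mulr1.
pose F (x : R) := c^-1 * (x - a) `^ c.
have -> : (b - a) `^ c / c = F b - F a.
  by rewrite /F subrr powR0// mulr0 subr0 mulrC.
apply: ge0_FTC2_oc => //.
- by move=> x _; exact: powR_ge0.
- move=> x /andP[ax _]; have [dfx _] := isd (c - 1) x ax.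
  exact/differentiable_continuous/derivable1_diffP.
- move=> x /andP[ax _]; have := is_deriveZ c^-1 (isd c x ax).
  by rewrite /GRing.scale/= mulrA mulVf// mul1r.
- rewrite /F subrr powR0//; apply: cvgM; first exact: cvg_cst.
  apply/cvg_at_rightP => v [va vcvg].
  move/cvg_at_rightP : (powR_cvg0 c0); apply; split.
    by move=> k; rewrite subr_gt0.
  by rewrite -(subrr a); apply: cvgB vcvg (cvg_cst _).
Qed.

(** * Euler's Gamma function: functional equation and positivity *)

Section EulerGamma.
Variables (R : realType) (z : R).
Hypothesis z_gt0 : 0 < z.
Local Notation mu := (@lebesgue_measure R).
(** [q] is the integrand of [Gamma (z + 1)] and [p] that of [z * Gamma z]. On the positive axis
    [p - q] is the derivative of [q], which vanishes at both ends; hence the two integrals agree. *)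
Let q (x : R) : R := x `^ z * expR (- x).
Let p (x : R) : R := z * (x `^ (z - 1) * expR (- x)).

Let zN0 : z != 0. Proof. by rewrite gt_eqF. Qed.

Let q_ge0 x : 0 <= q x. Proof. by rewrite mulr_ge0 ?powR_ge0 ?expR_ge0. Qed.

Let p_ge0 x : 0 <= p x.
Proof. by rewrite mulr_ge0 ?(ltW z_gt0)// mulr_ge0 ?powR_ge0 ?expR_ge0. Qed.

Let mexpRN : measurable_fun [set: R] (fun x : R => expR (- x)).
Proof. by apply: measurableT_comp => //; exact: measurable_oppr. Qed.

Let mq : measurable_fun [set: R] q.
Proof. by apply: measurable_funM => //; exact: measurable_powR. Qed.

Let mp : measurable_fun [set: R] p.
Proof.
apply: measurable_funM => //.
by apply: measurable_funM => //; exact: measurable_powR.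
Qed.

(** The factor [z - x] shows where the derivative of [q] changes sign. *)
Let pBqE x : 0 <= x -> p x - q x = (z - x) * x `^ (z - 1) * expR (- x).
Proof. by move=> x0; rewrite /p /q -(mulr_powRB1 x0 z_gt0); ring. Qed.

Let is_derive_expRN (x : R) : is_derive x 1 (fun x => expR (- x)) (- expR (- x)).
Proof.
have := is_derive1_comp (is_derive_expR (- x)) (is_deriveN (is_derive_id x 1)).
by rewrite mulrN1.
Qed.

Let is_derive_q (x : R) : 0 < x -> is_derive x 1 q (p x - q x).
Proof.
move=> x0; have := is_deriveM (is_derive1_powR z x0) (is_derive_expRN x).
by congr is_derive; rewrite /GRing.scale/= /p /q; ring.
Qed.

Let derivable_p (x : R) : 0 < x -> derivable p x 1.
Proof.
move=> x0; have := is_deriveZ z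
  (is_deriveM (is_derive1_powR (z - 1) x0) (is_derive_expRN x)).
by case.
Qed.

Let continuous_pBq (x : R) : 0 < x -> {for x, continuous (fun x => p x - q x)}.
Proof.
move=> x0; apply: differentiable_continuous; apply/derivable1_diffP.
by apply: derivableB; [exact: derivable_p| case: (is_derive_q x x0)].
Qed.

(** Half of the exponential absorbs the power: [x / (2 * z) <= 1 + x / (2 * z) <= expR (x / (2 *
    z))], raised to the power [z]. The bound yields both the limit of [q] at infinity and its
    integrability. *)
Let q_le x : 0 <= x -> q x <= (2 * z) `^ z * expR (- (2^-1 * x)).
Proof.
move=> x0; rewrite [in leRHS](_ : - _ = 2^-1 * x - x); last by field.
rewrite expRD mulrA ler_wpM2r ?expR_ge0//.
have -> : 2^-1 * x = x / (2 * z) * z by field.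
rewrite expRM -powRM ?expR_ge0 ?mulr_ge0 ?(ltW z_gt0)//.
apply: ge0_ler_powR; rewrite ?nnegrE ?(ltW z_gt0)// ?mulr_ge0 ?expR_ge0 ?(ltW z_gt0)//.
rewrite mulrC -ler_pdivrMr ?mulr_gt0//.
by rewrite (le_trans _ (expR_ge1Dx _))// lerDr.
Qed.

Let cvg_expR_half : expR (- (2^-1 * x)) @[x --> +oo] --> (0 : R).
Proof.
apply: (@cvg_comp _ _ _ (fun x : R => 2^-1 * x) (fun x => expR (- x)) _ +oo).
  by apply: gt0_cvgMry => //; exact: cvg_id.
exact: cvgr_expR.
Qed.

Let cvg_q : q x @[x --> +oo] --> (0 : R).
Proof.
apply: (@squeeze_cvgr _ _ _ _ (cst 0) (fun x => (2 * z) `^ z * expR (- (2^-1 * x)))).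
- near=> x; rewrite q_ge0 q_le//; near: x; exact: nbhs_pinfty_ge.
- exact: cvg_cst.
- rewrite -(mulr0 ((2 * z) `^ z)); apply: cvgM => //; exact: cvg_cst.
Unshelve. all: by end_near. Qed.

(* The derivative [p - q] of [q] is nonnegative on ]0, z] and nonpositive beyond:
   splitting at [z] needs the fundamental theorem for signed integrands only. *)
Let integral_lo :
  (\int[mu]_(x in `]0%R, z]) (p x - q x)%:E = (q z)%:E)%E.
Proof.
rewrite integral_itv_obnd_cbnd; last first.
  by apply/measurable_EFinP; apply: measurable_funTS; exact: measurable_funB.
have -> : q z = q z - q 0 by rewrite /q powR0// mul0r subr0.
apply: ge0_FTC2_oc => //.
- move=> x /andP[x0 xz]; rewrite pBqE ?(ltW x0)//.
  by rewrite mulr_ge0 ?expR_ge0// mulr_ge0 ?powR_ge0// subr_ge0.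
- by move=> x /andP[x0 _]; exact: continuous_pBq.
- by move=> x /andP[x0 _]; exact: is_derive_q.
- apply: cvgM; first by rewrite powR0//; exact: powR_cvg0.
  apply: (@cvg_at_right_filter _ _ (fun x => expR (- x))).
  have [d0 _] := is_derive_expRN 0.
  have c0 : {for 0, continuous (fun x : R => expR (- x))}.
    exact/differentiable_continuous/derivable1_diffP.
  exact: c0.
Qed.

Let integral_hi :
  (\int[mu]_(x in `]z, +oo[) (q x - p x)%:E = (q z)%:E)%E.
Proof.
rewrite integral_itv_obnd_cbnd; last first.
  by apply/measurable_EFinP; apply: measurable_funTS; exact: measurable_funB.
have dNq (x : R) : 0 < x -> is_derive x 1 (fun x => - q x) (q x - p x).
  move=> x0; have dq := is_derive_q x x0; by have := is_deriveN dq; rewrite opprB.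
have -> : ((q z)%:E = 0%:E - (- q z)%:E)%E by rewrite -EFinB sub0r opprK.
apply: (@ge0_continuous_FTC2y R _ (fun x => - q x) z 0).
- move=> x zx; have x0 := le_trans (ltW z_gt0) zx.
  rewrite -opprB pBqE// -!mulNr opprB.
  by rewrite mulr_ge0 ?expR_ge0// mulr_ge0 ?powR_ge0// subr_ge0.
- apply: continuous_in_subspaceT => x; rewrite inE/= in_itv/= andbT => zx.
  have -> : (fun x => q x - p x) = (fun x => - (p x - q x)).
    by apply/funext => y; rewrite opprB.
  apply: cvgN; apply: continuous_pBq; exact: lt_le_trans zx.
- by rewrite -oppr0; exact: cvgN.
- by move=> x zx; have [] := dNq x (lt_trans z_gt0 zx).
- apply: (@cvg_at_right_filter _ _ (fun x => - q x)).
  have [dz _] := dNq z z_gt0.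
  have cz : {for z, continuous (fun x : R => - q x)}.
    exact/differentiable_continuous/derivable1_diffP.
  exact: cz.
- move=> x; rewrite in_itv/= andbT => zx; have := dNq x (lt_trans z_gt0 zx).
  by move=> dx; rewrite derive1E derive_val.
Qed.

Let measurable_EFin (D : set R) (g : R -> R) : measurable D ->
  measurable_fun [set: R] g -> measurable_fun D (EFin \o g).
Proof. by move=> mD mg; apply/measurable_EFinP; exact: measurable_funTS. Qed.

Let splitD : `]0, +oo[%classic = `]0, z]%classic `|` `]z, +oo[%classic :> set R.
Proof. by apply: itv_bndbnd_setU; rewrite bnd_simp// ltW. Qed.

Let integral_split (g : R -> R) : (forall x, 0 <= g x) ->
  measurable_fun [set: R] g ->
  (\int[mu]_(x in `]0%R, +oo[) (g x)%:E = \int[mu]_(x in `]0%R, z]) (g x)%:E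
    + \int[mu]_(x in `]z, +oo[) (g x)%:E)%E.
Proof.
move=> g0 mg; rewrite splitD ge0_integral_setU//.
- by apply: measurable_EFin => //; exact: measurableU.
- by move=> x _; rewrite lee_fin.
- apply/disj_setPS => x /= []; rewrite !in_itv/= andbT => /andP[_ xz].
  by rewrite ltNge xz.
Qed.

(** Up to [z] the integral of [p] exceeds that of [q] by [q z]; beyond [z] it is the reverse.
    Written as sums of nonnegative extended reals, the two identities combine before finiteness is
    known. *)
Let integral_pq :
  (\int[mu]_(x in `]0%R, +oo[) (q x)%:E = \int[mu]_(x in `]0%R, +oo[) (p x)%:E)%E.
Proof.
rewrite !integral_split//.
have -> : (\int[mu]_(x in `]0%R, z]) (p x)%:E =
    (q z)%:E + \int[mu]_(x in `]0%R, z]) (q x)%:E)%E.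
  rewrite -integral_lo -ge0_integralD//=.
  - by apply: eq_integral => x _; rewrite -EFinD subrK.
  - move=> x; rewrite in_itv/= => /andP[x0 xz]; rewrite lee_fin pBqE ?(ltW x0)//.
    by rewrite mulr_ge0 ?expR_ge0// mulr_ge0 ?powR_ge0// subr_ge0.
  - by apply: measurable_EFin => //; exact: measurable_funB.
  - by move=> x _; rewrite lee_fin.
  - exact: measurable_EFin.
have -> : (\int[mu]_(x in `]z, +oo[) (q x)%:E =
    (q z)%:E + \int[mu]_(x in `]z, +oo[) (p x)%:E)%E.
  rewrite -integral_hi -ge0_integralD//=.
  - by apply: eq_integral => x _; rewrite -EFinD subrK.
  - move=> x; rewrite in_itv/= andbT => zx; rewrite lee_fin -opprB.
    rewrite pBqE ?(le_trans (ltW z_gt0) (ltW zx))// -!mulNr opprB.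
    by rewrite mulr_ge0 ?expR_ge0// mulr_ge0 ?powR_ge0// subr_ge0 ltW.
  - by apply: measurable_EFin => //; exact: measurable_funB.
  - by move=> x _; rewrite lee_fin.
  - exact: measurable_EFin.
by rewrite addeCA addeA.
Qed.

Let integral_q_lty : (\int[mu]_(x in `]0%R, +oo[) (q x)%:E < +oo)%E.
Proof.
pose M := (2 * z) `^ z; pose g x := M * expR (- (2^-1 * x)).
have mg : measurable_fun [set: R] g.
  apply: measurable_funM => //; apply: measurableT_comp mexpRN _.
  exact: measurable_funM.
(* [- 2 * g] is a primitive of the dominating function [g], and tends to 0 at infinity. *)
have dG (x : R) : is_derive x 1 (fun x => - 2 * g x) (g x).
  have dl : is_derive x 1 (fun x : R => 2^-1 * x) (2^-1 * 1).
    by have := is_deriveZ 2^-1 (is_derive_id x 1).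
  have := is_deriveZ (- 2 * M) (is_derive1_comp (is_derive_expRN (2^-1 * x)) dl).
  rewrite /GRing.scale/= /comp.
  have -> : - 2 * M * (- expR (- (2^-1 * x)) * (2^-1 * 1)) = g x.
    by rewrite /g; field.
  have -> // : (fun x => - 2 * g x) = (fun x => (- 2 * M) * expR (- (2^-1 * x))).
  by apply/funext => y; rewrite /g mulrA.
have M0 : 0 <= M by exact: powR_ge0.
apply: (@le_lt_trans _ _ (\int[mu]_(x in `]0%R, +oo[) (g x)%:E)%E).
  apply: ge0_le_integral => //=.
  - by move=> x _; rewrite lee_fin.
  - exact: measurable_EFin.
  - exact: measurable_EFin.
  - by move=> x; rewrite in_itv/= andbT => /ltW x0; rewrite lee_fin q_le.
rewrite integral_itv_obnd_cbnd; last exact: measurable_EFin.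
have -> : (\int[mu]_(x in `[0%R, +oo[) (g x)%:E = 0%:E - (- 2 * g 0)%:E)%E.
  have cG (x : R) : {for x, continuous (fun x => - 2 * g x)}.
    have [dx _] := dG x; exact/differentiable_continuous/derivable1_diffP.
  apply: (@ge0_continuous_FTC2y R _ (fun x => - 2 * g x) 0 0).
  - by move=> x _; rewrite mulr_ge0 ?expR_ge0.
  - apply: continuous_in_subspaceT => x _.
    have -> : g = (fun x => - 2^-1 * (- 2 * g x)) by apply/funext => y; field.
    by apply: cvgM; [exact: cvg_cst|exact: cG].
  - rewrite -(mulr0 (- 2)); apply: cvgM; first exact: cvg_cst.
    by rewrite -(mulr0 M); apply: cvgM => //; exact: cvg_cst.
  - by move=> x _; have [] := dG x.
  - by apply: cvg_at_right_filter; exact: cG.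
  - by move=> x _; have dx := dG x; rewrite derive1E derive_val.
exact: ltry.
Qed.

Let integral_pE : (\int[mu]_(x in `]0%R, +oo[) (p x)%:E =
  z%:E * \int[mu]_(x in `]0%R, +oo[) (x `^ (z - 1) * expR (- x))%:E)%E.
Proof.
rewrite -ge0_integralZl//=; last by rewrite lee_fin ltW.
  apply: measurable_EFin => //.
  by apply: measurable_funM => //; exact: measurable_powR.
by move=> x _; rewrite lee_fin mulr_ge0 ?powR_ge0 ?expR_ge0.
Qed.

Let integral_p_lty : (\int[mu]_(x in `]0%R, +oo[) (p x)%:E < +oo)%E.
Proof. by rewrite -integral_pq. Qed.

(** [Gamma] is a real-valued integral, in which [fine] would turn an infinite value into 0.
    Finiteness follows from that of the integral of [p], since [z > 0]. *)
Let Gamma_fin :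
  (\int[mu]_(x in `]0%R, +oo[) (x `^ (z - 1) * expR (- x))%:E = (Gamma z)%:E)%E.
Proof.
rewrite /Gamma /Rintegral fineK//.
have i0 : (0 <= \int[mu]_(x in `]0%R, +oo[) (x `^ (z - 1) * expR (- x))%:E)%E.
  by apply: integral_ge0 => x _; rewrite lee_fin mulr_ge0 ?powR_ge0 ?expR_ge0.
rewrite ge0_fin_numE// ltey; apply/negP => /eqP ioo.
by move: integral_p_lty; rewrite integral_pE ioo gt0_muley ?lte_fin.
Qed.

Lemma Gamma_succ : Gamma (z + 1) = z * Gamma z.
Proof.
apply/EFin_inj; rewrite EFinM -Gamma_fin -integral_pE -integral_pq.
rewrite /Gamma /Rintegral addrK fineK// ge0_fin_numE ?integral_q_lty//.
by apply: integral_ge0 => x _; rewrite lee_fin; exact: q_ge0.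
Qed.

(** [z * Gamma z] is the integral of [p], hence at least that of [p - q] over []0, z]], which equals
    [q z > 0]. *)
Lemma Gamma_gt0 : 0 < Gamma z.
Proof.
rewrite -(pmulr_rgt0 _ z_gt0) -lte_fin EFinM -Gamma_fin -integral_pE.
apply: (@lt_le_trans _ _ (q z)%:E).
  by rewrite lte_fin mulr_gt0 ?powR_gt0 ?expR_gt0.
rewrite -integral_lo integral_split//.
apply: (@le_trans _ _ (\int[mu]_(x in `]0%R, z]) (p x)%:E)%E).
  apply: ge0_le_integral => //=.
  - move=> x; rewrite in_itv/= => /andP[x0 xz]; rewrite lee_fin pBqE ?(ltW x0)//.
    by rewrite mulr_ge0 ?expR_ge0// mulr_ge0 ?powR_ge0// subr_ge0.
  - by apply: measurable_EFin => //; exact: measurable_funB.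
  - exact: measurable_EFin.
  - by move=> x _; rewrite lee_fin lerBlDr lerDl.
by rewrite leeDl// integral_ge0// => x _; rewrite lee_fin.
Qed.

End EulerGamma.

(** * Reflection of integrals and the weighted trapezoid estimate *)

(** The reflection preserves the length of intervals, so by uniqueness it preserves Lebesgue
    measure. Nonnegative functions come first, then positive and negative parts separately, so that
    integrability is not at issue. *)
Lemma integral_itv_reflection (R : realType) (a b : R) (g : R -> \bar R) :
  measurable_fun (`[a, b] : set R) g ->
  (\int[@lebesgue_measure R]_(x in `[a, b]) g (a + b - x)%R =
   \int[@lebesgue_measure R]_(x in `[a, b]) g x)%E.
Proof.
move=> mg.
pose phi : R -> measurableTypeR R := fun x => a + b - x.
have mphi : measurable_fun setT phi by exact: measurable_funB.
have refl_itv : phi @^-1` `[a, b] = `[a, b]%classic.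
  by apply/seteqP; split => x /=; rewrite !in_itv/= /phi => /andP[? ?];
    apply/andP; split; lra.
pose phi_mixin := isMeasurableFun.Build _ _ _ _ _ mphi.
pose phi_mfun : {mfun _ >-> _} := HB.pack phi phi_mixin.
have muphi (A : set R) : measurable A ->
    pushforward (@lebesgue_measure R) phi A = lebesgue_measure A.
  move=> mA; apply/esym.
  apply: (@lebesgue_measure_unique _ (pushforward (@lebesgue_measure R) phi_mfun)) => //.
  move=> _ [[u v]] _ <-; rewrite /= /pushforward.
  have -> : phi @^-1` `]u, v]%classic = `[a + b - v, a + b - u[%classic.
    by apply/seteqP; split => x /=; rewrite !in_itv/= /phi => /andP[? ?];
      apply/andP; split; lra.
  rewrite !lebesgue_measure_itv/= !lte_fin ltrD2l ltrN2.
  by case: ifP => // _; rewrite -!EFinD; congr EFin; ring.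
have ge0_case (h : R -> \bar R) : measurable_fun (`[a, b] : set R) h ->
    (forall x, 0 <= h x)%E ->
    (\int[@lebesgue_measure R]_(x in `[a, b]) h (phi x) =
     \int[@lebesgue_measure R]_(x in `[a, b]) h x)%E.
  move=> mh h0.
  transitivity (\int[@lebesgue_measure R]_(x in phi @^-1` `[a, b]) (h \o phi) x)%E.
    by rewrite refl_itv.
  rewrite -ge0_integral_pushforward//.
  by apply: eq_measure_integral => A mA _; exact: muphi.
rewrite integralE [RHS]integralE; congr (_ - _)%E.
- rewrite -(ge0_case g^\+%E)//; last exact: measurable_funepos.
  by apply: eq_integral => x _; rewrite !funeposE.
- rewrite -(ge0_case g^\-%E)//; last exact: measurable_funeneg.
  by apply: eq_integral => x _; rewrite !funenegE.
Qed.

Lemma integrable_powR_shift (R : realType) (a b c : R) : a < b -> 0 < c ->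
  (@lebesgue_measure R).-integrable `[a, b] (EFin \o (fun x => (x - a) `^ (c - 1))).
Proof.
move=> ab c0; apply/integrableP; split.
  apply/measurable_EFinP; apply: measurable_funTS.
  apply: (measurableT_comp (measurable_powR _)); exact: measurable_funB.
under eq_integral do rewrite gee0_abs ?lee_fin ?powR_ge0//.
by rewrite integral_powR_shift// ltry.
Qed.

Lemma Rintegral_powR_shift (R : realType) (a b c : R) : a < b -> 0 < c ->
  \int[@lebesgue_measure R]_(x in `[a, b]) (x - a) `^ (c - 1) = (b - a) `^ c / c.
Proof. by move=> ab c0; rewrite /Rintegral integral_powR_shift. Qed.

(** The hypothesis controls the symmetric increment near [a] only; its invariance under
    [t -> a + b - t] gives the same control near [b]. *)
Lemma fractional_trapezoid_bound (R : realType) (a b be C : R) (F : R -> R) :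
  a < b -> 0 < be ->
  {within `[a, b], continuous F} ->
  (forall t, a <= t <= b ->
    `|F a + F b - F t - F (a + b - t)| <= C * (t - a)) ->
  `|(F a + F b) / 2 - be / (2 * (b - a) `^ be)
      * (\int[@lebesgue_measure R]_(t in `[a, b]) (F t / (b - t) `^ (1 - be))
       + \int[@lebesgue_measure R]_(t in `[a, b]) (F t / (t - a) `^ (1 - be)))|
  <= C * (b - a) * be / ((be + 1) * (be + 2)).
Proof.
move=> ab be0 cF PC.
pose k (t : R) := (t - a) `^ (be - 1).
pose P (t : R) := F a + F b - F t - F (a + b - t).
have h0 : 0 < b - a by rewrite subr_gt0.
have hbe0 : 0 < (b - a) `^ be by rewrite powR_gt0.
have mD : measurable (`[a, b]%classic : set (measurableTypeR R)) by exact: measurable_itv.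
have kE t : ((t - a) `^ (1 - be))^-1 = k t by rewrite -powRN opprB.
have k_ge0 t : 0 <= k t by exact: powR_ge0.
have mF : measurable_fun (`[a, b] : set R) F.
  by apply: subspace_continuous_measurable_fun.
have [M [Mreal FM]] : bounded_set (F @` `[a, b]).
  by apply: compact_bounded; apply: continuous_compact => //; exact: segment_compact.
(* Boundedness provides [M] such that every number above [M] is a bound; [|M| + 1] is such a
   number. *)
have Fle t : a <= t <= b -> `|F t| <= `|M| + 1.
  move=> tab; apply: FM; last by exists t => //=; rewrite in_itv.
  by rewrite (le_lt_trans (ler_norm _))// ltrDl.
have reflab t : a <= t <= b -> a <= a + b - t <= b.
  by move=> /andP[? ?]; apply/andP; split; lra.
have mFr : measurable_fun (`[a, b] : set R) (fun t => F (a + b - t)).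
  apply: (measurable_comp (F := `[a, b]%classic)) => //.
    by move=> _ [t /= + <-]; rewrite !in_itv/=; exact: reflab.
  by apply: measurable_funB.
have ik : (@lebesgue_measure R).-integrable `[a, b] (EFin \o k).
  exact: integrable_powR_shift.
(* The kernel [k] is unbounded at [a] when [be < 1]; a bounded measurable factor keeps the product
   integrable. *)
have iMk (g : R -> R) : measurable_fun (`[a, b] : set R) g ->
    (forall t, a <= t <= b -> `|g t| <= `|M| + 1) ->
    (@lebesgue_measure R).-integrable `[a, b] (EFin \o (fun t => g t * k t)).
  move=> mg gM.
  have gb : [bounded g t | t in (`[a, b] : set R)].
    exists (`|M| + 1); split; first exact: num_real.
    move=> y My t /=; rewrite in_itv/= => /gM gt.
    by rewrite (le_trans gt)// ltW.
  have := @integrableMr _ (measurableTypeR R) R (@lebesgue_measure R) _ mD g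
    (EFin \o k) mg gb ik.
  by apply: eq_integrable => // t _ /=; rewrite EFinM.
have iF := iMk _ mF Fle.
have iFr := iMk _ mFr (fun t tab => Fle _ (reflab t tab)).
have -> : \int[@lebesgue_measure R]_(t in `[a, b]) (F t / (b - t) `^ (1 - be)) =
    \int[@lebesgue_measure R]_(t in `[a, b]) (F (a + b - t) * k t).
  rewrite /Rintegral
    -(integral_itv_reflection _ _ _ (fun t => (F t / (b - t) `^ (1 - be))%:E)).
    congr fine; apply: eq_integral => t _.
    by rewrite -kE; congr (EFin (_ / _ `^ _)); ring.
  apply/measurable_EFinP; apply: measurable_funM => //.
  have -> : (fun t => ((b - t) `^ (1 - be))^-1) = (fun t => (b - t) `^ (be - 1)).
    by apply/funext => t; rewrite -powRN opprB.
  apply: measurable_funTS; apply: (measurableT_comp (measurable_powR _)).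
  exact: measurable_funB.
have -> : \int[@lebesgue_measure R]_(t in `[a, b]) (F t / (t - a) `^ (1 - be)) =
    \int[@lebesgue_measure R]_(t in `[a, b]) (F t * k t).
  by apply: eq_Rintegral => t _; rewrite kE.
have intk : \int[@lebesgue_measure R]_(t in `[a, b]) k t = (b - a) `^ be / be.
  exact: Rintegral_powR_shift.
have intP : \int[@lebesgue_measure R]_(t in `[a, b]) (P t * k t) =
    (F a + F b) * ((b - a) `^ be / be)
    - (\int[@lebesgue_measure R]_(t in `[a, b]) (F (a + b - t) * k t)
     + \int[@lebesgue_measure R]_(t in `[a, b]) (F t * k t)).
  rewrite -intk -RintegralZl// -RintegralD// -RintegralB//.
  - by apply: eq_Rintegral => t _; rewrite /P; ring.
  - by have := integrableZl mD (F a + F b) ik.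
  - by have := integrableD mD iFr iF.
(* The prefactor times the integral of [k] is [1 / 2], so the average of the boundary values moves
   under the integral. *)
have -> : (F a + F b) / 2 - be / (2 * (b - a) `^ be) *
    (\int[@lebesgue_measure R]_(t in `[a, b]) (F (a + b - t) * k t)
     + \int[@lebesgue_measure R]_(t in `[a, b]) (F t * k t)) =
    be / (2 * (b - a) `^ be) * \int[@lebesgue_measure R]_(t in `[a, b]) (P t * k t).
  by rewrite intP; field; rewrite !gt_eqF.
have iPk : (@lebesgue_measure R).-integrable `[a, b] (EFin \o (fun t => P t * k t)).
  have := integrableB mD (integrableB mD (integrableZl mD (F a + F b) ik) iF) iFr.
  apply: eq_integrable => // t _ /=.
  by congr EFin; rewrite /P; ring.
(* [K] is [2 * C / (b - a) * (t - a) * (b - t) * k t], expanded with [b - t = (b - a) - (t - a)].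
   The exponents [c1] and [c2] put both terms in the form whose integral is known. *)
pose c1 : R := be + 1; pose c2 : R := be + 2.
have c10 : 0 < c1 by rewrite addr_gt0.
have c20 : 0 < c2 by rewrite addr_gt0.
pose K (t : R) := 2 * C * (t - a) `^ (c1 - 1) - 2 * C / (b - a) * (t - a) `^ (c2 - 1).
have iK1 : (@lebesgue_measure R).-integrable `[a, b]
    (EFin \o (fun t => 2 * C * (t - a) `^ (c1 - 1))).
  by have := integrableZl mD (2 * C) (integrable_powR_shift _ _ _ _ ab c10).
have iK2 : (@lebesgue_measure R).-integrable `[a, b]
    (EFin \o (fun t => 2 * C / (b - a) * (t - a) `^ (c2 - 1))).
  by have := integrableZl mD (2 * C / (b - a)) (integrable_powR_shift _ _ _ _ ab c20).
have iK : (@lebesgue_measure R).-integrable `[a, b] (EFin \o K).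
  exact: integrableB iK1 iK2.
have PkK t : a <= t <= b -> `|P t * k t| <= K t.
  move=> /[dup] tab /andP[at_ tb].
  have ta0 : 0 <= t - a by rewrite subr_ge0.
  have -> : K t = 2 * C / (b - a) * (t - a) * (b - t) * k t.
    rewrite /K /k.
    have -> : (t - a) `^ (c2 - 1) = (t - a) * (t - a) `^ (c1 - 1).
      have -> : c1 - 1 = c2 - 1 - 1 by rewrite /c1 /c2; ring.
      by rewrite mulr_powRB1// /c2; lra.
    have -> : (t - a) `^ (c1 - 1) = (t - a) * (t - a) `^ (be - 1).
      by rewrite mulr_powRB1// /c1 addrK.
    by field; rewrite gt_eqF.
  rewrite normrM (ger0_norm (k_ge0 t)) ler_wpM2r//.
  have P1 : `|P t| <= C * (t - a) by exact: PC.
  have P2 : `|P t| <= C * (b - t).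
    have := PC _ (reflab t tab).
    have -> : a + b - (a + b - t) = t by ring.
    have -> : a + b - t - a = b - t by ring.
    by rewrite addrAC.
  (* The minimum of [t - a] and [b - t] is at most their harmonic mean. *)
  rewrite -(ler_pM2r h0).
  have -> : 2 * C / (b - a) * (t - a) * (b - t) * (b - a) =
      C * (b - t) * (t - a) + C * (t - a) * (b - t).
    by field; rewrite gt_eqF.
  have -> : `|P t| * (b - a) = `|P t| * (t - a) + `|P t| * (b - t) by ring.
  by rewrite lerD// ler_wpM2r// subr_ge0.
(* The two terms contribute [1 / (be + 1) - 1 / (be + 2)], which is the reciprocal of the
   product. *)
have intK : \int[@lebesgue_measure R]_(t in `[a, b]) K t =
    2 * C * (b - a) * (b - a) `^ be / ((be + 1) * (be + 2)).
  rewrite /K RintegralB// !RintegralZl//; last 2 first.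
    exact: integrable_powR_shift.
    exact: integrable_powR_shift.
  rewrite !Rintegral_powR_shift//.
  have -> : (b - a) `^ c2 = (b - a) * (b - a) `^ c1.
    have -> : c1 = c2 - 1 by rewrite /c1 /c2; ring.
    by rewrite mulr_powRB1// ltW.
  have -> : (b - a) `^ c1 = (b - a) * (b - a) `^ be.
    have -> : be = c1 - 1 by rewrite /c1; ring.
    by rewrite mulr_powRB1// ltW.
  by rewrite /c1 /c2; field; rewrite !gt_eqF.
rewrite normrM ger0_norm; last by rewrite divr_ge0// ?mulr_ge0// ltW.
have -> : C * (b - a) * be / ((be + 1) * (be + 2)) =
    be / (2 * (b - a) `^ be) * \int[@lebesgue_measure R]_(t in `[a, b]) K t.
  by rewrite intK; field; rewrite !gt_eqF.
rewrite ler_wpM2l ?divr_ge0 ?mulr_ge0 ?(ltW be0) ?(ltW hbe0)//.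
apply: (le_trans (le_normr_Rintegral mD iPk)).
apply: le_Rintegral => //; first exact: integrable_norm.
Qed.

(** * Derivatives relative to an interval and the mean value estimate *)

(** At an interior point the restriction to [I] does not change the punctured neighbourhoods, and
    the substitution [y = h + x] gives the usual difference quotient. This opens the way to the mean
    value theorem. *)
Lemma is_derive_on (R : realType) (I : set R) (F : R -> R) (x : R) :
  nbhs x I -> derivable_on I F x -> is_derive x 1 F (derive_on I F x).
Proof.
move=> Ix dFx.
have wI : within I x^' = x^'.
  rewrite eqEsubset; split => A; last by apply: filterS => y Ay _.
  move=> wA; have nI : (x^') I by apply: filterS Ix => y Iy _.
  by move: nI wA; apply: filterS2 => y Iy; exact.
have dq : (F y - F x) / (y - x) @[y --> x^'] --> derive_on I F x.
  by move: dFx; rewrite /derivable_on /derive_on /diff_quot_on wI.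
have dq0 : h^-1 *: ((F \o shift x) (h *: 1) - F x) @[h --> 0^'] --> derive_on I F x.
  have shx : h + x @[h --> 0^'] --> x^'.
    have shx0 : h + x @[h --> (0 : R)] --> x.
      by rewrite -[X in _ --> X](add0r x); apply: cvgD; [exact: cvg_id|exact: cvg_cst].
    move=> P xP.
    have H : \forall h \near (0 : R), h + x != x -> P (h + x) by exact: shx0 xP.
    change (\forall h \near (0 : R), h != 0 -> P (h + x)).
    apply: filterS H => h + h0; apply.
    by rewrite -subr_eq0 addrK.
  have := cvg_comp _ _ shx dq; apply: cvg_trans; apply: near_eq_cvg.
  by apply: nearW => h; rewrite /= /GRing.scale/= mulr1 addrK mulrC.
apply: DeriveDef; first by apply/cvg_ex; exists (derive_on I F x).
exact/cvg_lim.
Qed.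

(** For [y != x], [F y] is [F x] plus the difference quotient times [y - x], and this last factor
    tends to 0. Endpoints of [I] are included. *)
Lemma derivable_on_continuous (R : realType) (I : set R) (F : R -> R) (x : R) :
  derivable_on I F x -> F y @[y --> within I (nbhs x)] --> F x.
Proof.
move=> dFx.
have dq : (F y - F x) / (y - x) @[y --> within I x^'] --> derive_on I F x by [].
have id0 : y - x @[y --> within I x^'] --> (0 : R).
  rewrite -(subrr x); apply: cvgB; last exact: cvg_cst.
  by apply: cvg_within_filter; exact: cvg_within.
have : F x + (F y - F x) / (y - x) * (y - x) @[y --> within I x^'] --> F x.
  rewrite -[X in _ --> X]addr0 -[X in _ --> _ + X](mulr0 (derive_on I F x)).
  by apply: cvgD; [exact: cvg_cst|exact: cvgM].
move=> cF U FU.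
have H : \forall y \near x, y != x -> I y ->
    U (F x + (F y - F x) / (y - x) * (y - x)) by exact: cF FU.
change (\forall y \near x, I y -> U (F y)).
apply: filterS H => y + Iy.
(* The punctured limit says nothing at [y = x], where [U (F x)] holds because [U] is a neighbourhood
   of [F x]. *)
have [->|yx] := eqVneq y x; first by move=> _; exact: nbhs_singleton FU.
by move=> /(_ isT Iy); rewrite divfK ?subr_eq0// addrC subrK.
Qed.

(** The increment vanishes at [t = a], and its derivative [- G x + G (a + b - x)] is at most [C] in
    absolute value; the mean value theorem on [[a, t]] concludes. *)
Lemma symmetric_increment_bound (R : realType) (a b C : R) (F G : R -> R) :
  {within `[a, b], continuous F} ->
  (forall x, a < x < b -> is_derive x 1 F (G x)) ->
  (forall x, a < x < b -> `|G x| + `|G (a + b - x)| <= C) ->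
  forall t, a <= t <= b ->
    `|F a + F b - F t - F (a + b - t)| <= C * (t - a).
Proof.
move=> cF dF GC t /andP[at_ tb].
pose P (t : R) := F a + F b - F t - F (a + b - t).
have refloo x : a < x < b -> a < a + b - x < b.
  by move=> /andP[? ?]; apply/andP; split; lra.
have dP (x : R) : x \in `]a, t[ -> is_derive x 1 P (- G x + G (a + b - x)).
  rewrite in_itv/= => /andP[ax xt].
  have xab : a < x < b by rewrite ax (lt_le_trans xt).
  have dr : is_derive x 1 (fun x : R => a + b - x) (- 1).
    by have := is_deriveB (is_derive_cst (a + b) x 1) (is_derive_id x 1); rewrite sub0r.
  have dFr := @is_derive1_comp _ F (fun x : R => a + b - x) x _ _ (dF _ (refloo x xab)) dr.
  have := is_deriveB (is_deriveB (is_derive_cst (F a + F b) x 1) (dF x xab)) dFr.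
  by rewrite sub0r mulrN1 opprK.
have cP : {within `[a, t], continuous P}.
  have sub : `[a, t] `<=` `[a, b].
    by move=> x /=; rewrite !in_itv/= => /andP[-> /le_trans]; exact.
  apply: (continuous_subspaceW sub).
  move/subspace_continuousP : cF => cF.
  apply/subspace_continuousP => x /= xab.
  have rxab : a + b - x \in `[a, b].
    by move: xab; rewrite !in_itv/= => /andP[? ?]; apply/andP; split; lra.
  (* The reflection maps [[a, b]] to itself, so it carries continuity relative to [[a, b]] from
     [a + b - x] back to [x]. *)
  have cr : a + b - y @[y --> within `[a, b] (nbhs x)] --> within `[a, b] (nbhs (a + b - x)).
    have c0 : a + b - y @[y --> nbhs x] --> a + b - x.
      by apply: cvgB; [exact: cvg_cst|exact: cvg_id].
    move=> U rU.
    have H : \forall y \near x, `[a, b]%classic (a + b - y) -> U (a + b - y) by exact: c0 rU.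
    change (\forall y \near x, `[a, b]%classic y -> U (a + b - y)).
    apply: filterS H => y Uy /=; rewrite in_itv/= => /andP[ay yb].
    by apply: Uy; rewrite /= in_itv/=; apply/andP; split; lra.
  apply: cvgB; last exact: cvg_comp cr (cF _ rxab).
  by apply: cvgB; [exact: cvg_cst|exact: cF].
have [->|at'] := eqVneq t a.
  by rewrite subrr mulr0 [a + b]addrC addrK addrAC addrK subrr normr0.
have lt_at : a < t by rewrite lt_neqAle eq_sym at'.
have [c ca] := MVT lt_at dP cP.
have -> : P a = 0 by rewrite /P [a + b]addrC addrK; ring.
rewrite subr0 -/(P t) => ->.
rewrite normrM (ger0_norm (_ : 0 <= t - a)) ?subr_ge0// ler_wpM2r ?subr_ge0//.
rewrite (le_trans (ler_normD _ _))// normrN GC//.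
by move: ca; rewrite in_itv/= => /andP[-> /lt_le_trans]; exact.
Qed.

(** * The trapezoid inequality for Caputo derivatives *)

Theorem theorem3 (R : realType) (alpha : R) (n : nat) (m : R) (I : set R)
    (a b : R) (f : R -> R)
    (alpha_gt0 : 0 < alpha)
    (alpha_nat : forall k : nat, (0 < k)%N -> alpha <> k%:R)
    (n_def : n = (Num.truncn alpha).+1)
    (m_gt0 : 0 < m) (m_le1 : m <= 1)
    (I_itv : is_interval I) (I_ge0 : I `<=` `[0, +oo[)
    (Ia : I a) (Ib : I b) (lt_ab : a < b)
    (I_divm : forall y : R, a <= y <= b -> I (y / m))
    (f_derivable : n_derivable_on I n.+1 f)
    (f_AC : AC_space I n a b f)
    (f_L : Lebesgue_integrable a b (deriven_on I n.+1 f))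
    (f_mconvex : m_convex m a b (fun x => `|deriven_on I n.+1 f x|)) :
  `| (deriven_on I n f a + deriven_on I n f b) / 2
     - Gamma (n%:R - alpha + 1) / (2 * (b - a) `^ (n%:R - alpha))
       * (caputo_left I alpha a f b + (-1) ^+ n * caputo_right I alpha b f a) |
  <= (b - a) / 2
     * (1 / (2 * (n%:R - alpha + 1)) + 1 / (2 * (n%:R - alpha + 2)))
     * (`|deriven_on I n.+1 f a| + m * `|deriven_on I n.+1 f (b / m)|).
Proof.
pose F := deriven_on I n f; pose G := deriven_on I n.+1 f; pose be : R := n%:R - alpha.
have be_gt0 : 0 < be by rewrite subr_gt0 n_def truncnS_gt.
(* The integer part of [alpha] is at most [alpha]; this upper bound serves in the final comparison
   of constants. *)
have be_le1 : be <= 1.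
  by rewrite lerBlDr n_def -natr1 addrC lerD2l truncn_le ltW.
have sub_ab x : a <= x <= b -> I x by exact: I_itv.
have dF x : a <= x <= b -> derivable_on I F x.
  by move=> /sub_ab Ix; exact: f_derivable.
(* Continuity relative to [I] restricts to the smaller set [[a, b]], endpoints included. *)
have cF : {within `[a, b], continuous F}.
  apply/subspace_continuousP => x /=; rewrite in_itv/= => xab.
  apply: cvg_trans (derivable_on_continuous _ _ _ _ (dF x xab)).
  apply: cvg_app; apply: within_subset => y /=; rewrite in_itv/=; exact: sub_ab.
have dFoo x : a < x < b -> is_derive x 1 F (G x).
  move=> /[dup] xoo /andP[ax xb]; apply: is_derive_on; last by apply: dF; rewrite !ltW.
  have : \forall y \near x, y \in `]a, b[ by apply: near_in_itvoo; rewrite in_itv.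
  apply: filterS => y; rewrite in_itv/= => /andP[/ltW ay /ltW yb].
  by apply: sub_ab; rewrite ay.
pose C := `|G a| + m * `|G (b / m)|.
have C_ge0 : 0 <= C by rewrite addr_ge0// mulr_ge0// ltW.
(* By convexity [|G x|] lies below an affine function [l] on [[a, b]] for which
   [l x + l (a + b - x)] is the constant [C]. *)
have GC x : a < x < b -> `|G x| + `|G (a + b - x)| <= C.
  move=> /andP[ax xb].
  have h0 : 0 < b - a by rewrite subr_gt0.
  pose t := (b - x) / (b - a).
  have aab : a <= a <= b by rewrite lexx ltW.
  have bab : a <= b <= b by rewrite lexx ltW.
  have t01 : 0 <= t <= 1.
    apply/andP; split; first by rewrite divr_ge0// ?subr_ge0 ltW.
    by rewrite ler_pdivrMr// mul1r lerD2l lerN2 ltW.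
  have t01' : 0 <= 1 - t <= 1 by move: t01 => /andP[? ?]; apply/andP; split; lra.
  have := f_mconvex a b t aab bab t01.
  have := f_mconvex a b (1 - t) aab bab t01'.
  have -> : (1 - t) * a + (1 - (1 - t)) * b = a + b - x.
    by rewrite /t; field; rewrite gt_eqF.
  have -> : t * a + (1 - t) * b = x by rewrite /t; field; rewrite gt_eqF.
  rewrite -/(G x) -/(G (a + b - x)) => H1 H2; rewrite (le_trans (lerD H2 H1))//.
  by rewrite /C le_eqVlt; apply/orP; left; apply/eqP; ring.
have := fractional_trapezoid_bound R a b be C F lt_ab be_gt0 cF
  (symmetric_increment_bound R a b C F G cF dFoo GC).
rewrite /caputo_left /caputo_right -n_def -/be -/F -/G -/C.
have -> : alpha - n%:R + 1 = 1 - be by rewrite /be; ring.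
(* [Gamma (be + 1) = be * Gamma be] cancels the factor [(Gamma be)^-1] common to both Caputo
   derivatives, once the two signs [(-1) ^+ n] have been multiplied to 1. *)
rewrite (Gamma_succ _ _ be_gt0).
have Gamma_neq0 : Gamma be != 0 by rewrite gt_eqF// Gamma_gt0.
have sgn2 : (-1) ^+ n * ((-1) ^+ n / Gamma be) = (Gamma be)^-1 :> R.
  by rewrite mulrA -expr2 sqrr_sign mul1r.
rewrite [(-1) ^+ n * _]mulrA sgn2 -mulrDr.
rewrite [_ * ((Gamma be)^-1 * _)]mulrA.
have -> : be * Gamma be / (2 * (b - a) `^ be) / Gamma be = be / (2 * (b - a) `^ be).
  by field; rewrite Gamma_neq0 gt_eqF ?powR_gt0 ?subr_gt0.
move=> /le_trans; apply.
have h0 : 0 < b - a by rewrite subr_gt0.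
(* The gap between the two bounds has the factor [3 - 2 * be], positive because [be <= 1]. *)
rewrite -subr_ge0.
have -> : (b - a) / 2 * (1 / (2 * (be + 1)) + 1 / (2 * (be + 2))) * C
    - C * (b - a) * be / ((be + 1) * (be + 2)) =
    C * (b - a) * (3 - 2 * be) / (4 * (be + 1) * (be + 2)).
  by field; apply/andP; split; apply/eqP; lra.
rewrite divr_ge0// ?mulr_ge0// ?(ltW h0)//; lra.
Qed.
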